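(* Let $(X,d,p)$ be a metric space with a marked point $p$. If all pretangent spaces $\Omega_{p,\tilde r}^{X}$ to $X$ at $p$ (for all normalizing sequences $\tilde r$) are CAT(0)-spaces, then $X$ is midpoint convex at $p$ and $$\liminf_{w,x,y,z\to p}A_{1}(w,x,y,z)\ge 0,$$ where $A_1:X^4\to\mathbb R$ is defined by $$A_{1}(w,x,y,z):= \frac{d^{2}(w,x)+d^{2}(x,y)+d^{2}(y,z)+d^{2}(z,w)-\bigl(d^{2}(w,y)+d^{2}(x,z)\bigr)}{\bigl(\max\{d(w,p),d(x,p),d(y,p),d(z,p)\}\bigr)^{2}}$$ for $(w,x,y,z)\neq(p,p,p,p)$ and $A_1(p,p,p,p):=0$.
   Context: Pretangent spaces. Let $(X,d,p)$ be a metric space with marked point $p$. A normalizing sequence is a sequence $\tilde r=\{r_n\}_{n\in\mathbb N}$ of positive reals with $r_n\to 0$. Let $\tilde X$ be the set of all sequences of points of $X$. Two sequences $\tilde x=\{x_n\},\tilde y=\{y_n\}\in\tilde X$ are mutually stable with respect to $\tilde r$ if the finite limit $\tilde d_{\tilde r}(\tilde x,\tilde y):=\lim_{n\to\infty} d(x_n,y_n)/r_n$ exists. A family $\tilde F\subseteq\tilde X$ is self-stable if any two of its elements are mutually stable; it is maximal self-stable if moreover for every $\tilde z\in\tilde X\setminus\tilde F$ there is $\tilde x\in\tilde F$ such that $\tilde x,\tilde z$ are not mutually stable. Let $\tilde X_{p,\tilde r}$ denote a maximal self-stable family (with respect to $\tilde r$) containing the constant sequence $\tilde p=(p,p,\dots)$.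 Then $(\tilde X_{p,\tilde r},\tilde d_{\tilde r})$ is a pseudometric space; the metric space $(\Omega_{p,\tilde r}^{X},\rho)$ obtained from it by identifying $\tilde x,\tilde y$ whenever $\tilde d_{\tilde r}(\tilde x,\tilde y)=0$, with $\rho$ induced by $\tilde d_{\tilde r}$, is called a pretangent space to $X$ at $p$ with respect to $\tilde r$. (There may be several pretangent spaces for one $\tilde r$, depending on the choice of $\tilde X_{p,\tilde r}$.) Midpoint convexity at $p$. $X$ is midpoint convex at $p$ if for any two sequences $\tilde x=\{x_n\}$, $\tilde y=\{y_n\}$ in $X$ converging to $p$ there is a sequence $\tilde z=\{z_n\}$ in $X$ (called an infinitesimal midpoint of $\tilde x,\tilde y$) such that, with $\delta_p(x,y):=\max\{d(x,p),d(y,p)\}$, $$\lim_{n\to\infty}\frac{|d(x_n,z_n)-\frac12 d(x_n,y_n)|}{\delta_p(x_n,y_n)}=\lim_{n\to\infty}\frac{|d(y_n,z_n)-\frac12 d(x_n,y_n)|}{\delta_p(x_n,y_n)}=0,$$ where, when $x_n=y_n=p$, the quotients are understood as $0$ if $z_n=p$ and as $+\infty$ if $z_n\ne p$. CAT(0)-space has its usual global meaning: a geodesic metric space of nonpositive curvature in the sense of Aleksandrov, i.e. geodesic triangles are not thicker than their Euclidean comparison triangles. *)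

(* Defs.v *)
From HB Require Import structures.
From mathcomp Require Import all_boot all_order all_algebra.
From mathcomp Require Import generic_quotient.
From mathcomp Require Import all_classical all_reals all_analysis.

Set Implicit Arguments.
Unset Strict Implicit.
Unset Printing Implicit Defensive.

Import Order.TTheory GRing.Theory Num.Theory.
Import numFieldNormedType.Exports.

Local Open Scope classical_set_scope.
Local Open Scope ring_scope.
Local Open Scope quotient_scope.

Section CAT0.
Context {R : realType}.

(* The norm carried by 'rV[R]_2 in the library is the sup norm, hence an
   explicit Euclidean distance. *)
Definition euclid_dist (a b : 'rV[R]_2) : R :=
  Num.sqrt (\sum_(i < 2) (a 0 i - b 0 i) ^+ 2).

Definition esegment (a b : 'rV[R]_2) : set 'rV[R]_2 :=
  [set (1 - t) *: a + t *: b | t in `[0, 1]].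

Context (T : metricType R).

Definition geodesic_segment (x y : T) (S : set T) : Prop :=
  exists c : R -> T,
    [/\ c 0 = x, c (mdist x y) = y,
        {in `[0, mdist x y] &, forall s t, mdist (c s) (c t) = `|s - t|}
      & S = c @` `[0, mdist x y]].

Definition geodesic_space : Prop :=
  forall x y : T, exists S : set T, geodesic_segment x y S.

Definition comparison_triangle (x y z : T) (x' y' z' : 'rV[R]_2) : Prop :=
  [/\ euclid_dist x' y' = mdist x y, euclid_dist y' z' = mdist y z
    & euclid_dist z' x' = mdist z x].

(* u' is the comparison point, on the side [x', y'], of the point u of the
   geodesic segment S joining x to y. *)
Definition comparison_point (x y : T) (S : set T) (x' y' : 'rV[R]_2)
    (u : T) (u' : 'rV[R]_2) : Prop :=
  [/\ S u, esegment x' y' u' & euclid_dist x' u' = mdist x u].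

Definition CAT0 : Prop :=
  geodesic_space /\
  forall (x y z : T) (Sxy Syz Szx : set T) (x' y' z' : 'rV[R]_2),
    geodesic_segment x y Sxy ->
    geodesic_segment y z Syz ->
    geodesic_segment z x Szx ->
    comparison_triangle x y z x' y' z' ->
    let comparison u u' :=
      [\/ comparison_point x y Sxy x' y' u u',
          comparison_point y z Syz y' z' u u'
        | comparison_point z x Szx z' x' u u'] in
    forall (u v : T) (u' v' : 'rV[R]_2),
      comparison u u' -> comparison v v' -> mdist u v <= euclid_dist u' v'.

End CAT0.

Record normalizingSeq (R : realType) := NormalizingSeq {
  nseq_val :> nat -> R;
  nseq_gt0 : forall n, 0 < nseq_val n;
  nseq_cvg0 : nseq_val @ \oo --> (0 : R)
}.

Section Stability.
Context {R : realType} {X : metricType R} (r : normalizingSeq R).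
Implicit Types (x y z : nat -> X) (F : set (nat -> X)).

Definition scaled_dist x y : nat -> R := fun n => mdist (x n) (y n) / r n.

Definition mutually_stable x y : Prop := cvgn (scaled_dist x y).

(* Meaningful only when x and y are mutually stable. *)
Definition dtilde x y : R := limn (scaled_dist x y).

Definition self_stable F : Prop :=
  forall x y, F x -> F y -> mutually_stable x y.

Definition maximal_self_stable F : Prop :=
  self_stable F /\
  forall z, ~ F z -> exists2 x, F x & ~ mutually_stable x z.

End Stability.

Record maximalFamily (R : realType) (X : metricType R) (r : normalizingSeq R)
    (p : X) := MaximalFamily {
  family :> set (nat -> X);
  family_maximal : maximal_self_stable r family;
  family_marked : family (cst p)
}.

Section Pretangent.
Context {R : realType} {X : metricType R} {r : normalizingSeq R} {p : X}.
Variable F : maximalFamily r p.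

Implicit Types x y z : set_type F.

Let dF x y : R := dtilde r (val x) (val y).

Let stableF x y : mutually_stable r (val x) (val y).
Proof. by apply: (family_maximal F).1; apply: set_valP. Qed.

Let dFxx x : dF x x = 0.
Proof.
rewrite /dF /dtilde (_ : scaled_dist _ _ _ = cst 0) ?lim_cst//.
by apply/funext => n; rewrite /scaled_dist mdistxx mul0r.
Qed.

Let dF_sym x y : dF x y = dF y x.
Proof.
rewrite /dF /dtilde; congr (limn _); apply/funext => n.
by rewrite /scaled_dist metric_sym.
Qed.

Let dF_triangle y x z : dF x z <= dF x y + dF y z.
Proof.
have sxy := @stableF x y; have syz := @stableF y z.
rewrite /dF /dtilde -limD//; apply: ler_lim.
- exact: stableF.
- exact: is_cvgD.
- apply: nearW => n; rewrite /scaled_dist -mulrDl ler_wpM2r//.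
    by rewrite invr_ge0 ltW// nseq_gt0.
  exact: metric_triangle.
Qed.

Let dF_ge0 x y : 0 <= dF x y.
Proof.
apply: limr_ge; first exact: stableF.
by apply: nearW => n; rewrite divr_ge0 ?mdist_ge0// ltW// nseq_gt0.
Qed.

Definition indistinguishable x y : bool :=
  dtilde r (val x) (val y) == 0.

Let ind_refl : reflexive indistinguishable.
Proof. by move=> x; apply/eqP/dFxx. Qed.

Let ind_sym : symmetric indistinguishable.
Proof. by move=> x y; rewrite /indistinguishable -/(dF x y) dF_sym. Qed.

Let ind_trans : transitive indistinguishable.
Proof.
move=> y x z /eqP xy /eqP yz; apply/eqP/le_anti; rewrite dF_ge0 andbT.
by have := dF_triangle y x z; rewrite /dF xy yz addr0.
Qed.

Canonical indistinguishable_equiv :=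
  EquivRel indistinguishable ind_refl ind_sym ind_trans.

Definition pretangent := {eq_quot indistinguishable}.

HB.instance Definition _ := Choice.on pretangent.
HB.instance Definition _ := EqQuotient.on pretangent.

Definition pretangent_dist (a b : pretangent) : R :=
  dtilde r (val (repr a)) (val (repr b)).

Let dF_congr x x' y y' : dF x x' = 0 -> dF y y' = 0 -> dF x y = dF x' y'.
Proof.
move=> xx' yy'; apply/le_anti/andP; split.
  rewrite (le_trans (dF_triangle x' _ _))// xx' add0r.
  by rewrite (le_trans (dF_triangle y' _ _))// (dF_sym y') yy' addr0.
rewrite (le_trans (dF_triangle x _ _))// dF_sym xx' add0r.
by rewrite (le_trans (dF_triangle y _ _))// yy' addr0.
Qed.

Let reprK0 x : dF (repr (\pi_pretangent x)) x = 0.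
Proof. by apply/eqP; have /eqmodP := reprK (\pi_pretangent x). Qed.

Lemma pretangent_dist_pi x y :
  pretangent_dist (\pi_pretangent x) (\pi_pretangent y) =
  dtilde r (val x) (val y).
Proof. exact: dF_congr. Qed.

Let pd_xx a : pretangent_dist a a = 0. Proof. exact: dFxx. Qed.

Let pd_positivity a b : pretangent_dist a b = 0 -> a = b.
Proof. by move=> ab; rewrite -[a]reprK -[b]reprK; apply/eqmodP/eqP. Qed.

Let pd_sym a b : pretangent_dist a b = pretangent_dist b a.
Proof. exact: dF_sym. Qed.

Let pd_triangle b a c :
  pretangent_dist a c <= pretangent_dist a b + pretangent_dist b c.
Proof. exact: dF_triangle. Qed.

HB.instance Definition _ :=
  isMetric.Build R pretangent pd_xx pd_positivity pd_sym pd_triangle.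

Lemma mdist_pretangentE (a b : pretangent) : mdist a b = pretangent_dist a b.
Proof. by []. Qed.

End Pretangent.

Section Infinitesimal.
Context {R : realType} {X : metricType R} (p : X).

Definition delta (x y : X) : R := Num.max (mdist x p) (mdist y p).

(* The quotient |d(a, z) - d(x, y) / 2| / delta_p(x, y), for a = x or a = y. *)
Definition midpoint_error (a x y z : X) : \bar R :=
  if (x == p) && (y == p) then (if z == p then 0%E else +oo%E)
  else (`|mdist a z - mdist x y / 2| / delta x y)%:E.

Definition infinitesimal_midpoint (x y z : nat -> X) : Prop :=
  midpoint_error (x n) (x n) (y n) (z n) @[n --> \oo] --> 0%E /\
  midpoint_error (y n) (x n) (y n) (z n) @[n --> \oo] --> 0%E.

Definition midpoint_convex : Prop :=
  forall x y : nat -> X, x @ \oo --> p -> y @ \oo --> p ->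
    exists z : nat -> X, infinitesimal_midpoint x y z.

Definition A1 (w x y z : X) : R :=
  if [&& w == p, x == p, y == p & z == p] then 0
  else (mdist w x ^+ 2 + mdist x y ^+ 2 + mdist y z ^+ 2 + mdist z w ^+ 2
        - (mdist w y ^+ 2 + mdist x z ^+ 2))
       / Num.max (Num.max (Num.max (mdist w p) (mdist x p)) (mdist y p))
                 (mdist z p) ^+ 2.

(* The lower limit of A1 along the neighbourhoods of (p, p, p, p) in the
   product X ^ 4, this point included. *)
Definition liminf_A1 : \bar R :=
  limf_einf (fun q : X * X * X * X => (A1 q.1.1.1 q.1.1.2 q.1.2 q.2)%:E)
            (nbhs (p, p, p, p)).

End Infinitesimal.

(* Main.v *)
Require Import Defs.
From mathcomp Require Import all_boot all_order all_algebra.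
From mathcomp Require Import generic_quotient.
From mathcomp Require Import all_classical all_reals all_analysis.
From mathcomp Require Import ring lra.

Set Implicit Arguments.
Unset Strict Implicit.
Unset Printing Implicit Defensive.

Import Order.TTheory GRing.Theory Num.Theory.
Import numFieldNormedType.Exports.

Local Open Scope classical_set_scope.
Local Open Scope ring_scope.
Local Open Scope quotient_scope.

(* A CAT(0)-space has midpoints and satisfies the quadrilateral inequality
   d(w,y)^2 + d(x,z)^2 <= d(w,x)^2 + d(x,y)^2 + d(y,z)^2 + d(z,w)^2.
   If either conclusion of the theorem failed, there would be finitely many
   sequences converging to p along which it fails by a fixed amount after
   division by r_n, the maximal distance to p of their n-th terms.  By
   Bolzano-Weierstrass all mutual distances divided by r_n converge along a
   subsequence, so these sequences lie in a common maximal self-stable family,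
   and the property of its pretangent space contradicts the failure. *)

(** * Subsequences along which finitely many bounded sequences converge *)

Section Sequences.

Lemma cvgn_oo_of_ge (s : nat -> nat) :
  (forall n, (n <= s n)%N) -> s @ \oo --> \oo.
Proof.
move=> s_ge A [N _ NA]; exists N => // n /= Nn; apply: NA => /=.
exact: leq_trans Nn (s_ge n).
Qed.

Lemma increasing_seq_cvgn (s : nat -> nat) : increasing_seq s -> s @ \oo --> \oo.
Proof.
move=> /increasing_seqP s_inc; apply: cvgn_oo_of_ge; elim=> // n IHn.
exact: leq_ltn_trans IHn (s_inc n).
Qed.

(** The sequences are treated one after another: each step extracts a further subsequence from the
    current one, and the limits already obtained persist along it. *)
Lemma bolzano_weierstrass_finite (R : realType) (I : finType) (u : I -> R^nat) :
  (forall i, bounded_fun (u i)) ->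
  exists2 s : nat -> nat, increasing_seq s & forall i, cvgn (u i \o s).
Proof.
move=> u_bnd; suff [s s_inc s_cvg] : exists2 s : nat -> nat, increasing_seq s &
    forall i, i \in enum I -> cvgn (u i \o s).
  by exists s => // i; apply: s_cvg; rewrite mem_enum.
elim: (enum I) => [|i l [s s_inc s_cvg]]; first by exists id.
have [|t t_inc t_cvg] := @bolzano_weierstrass R (u i \o s).
  have [M [Mreal uM]] := u_bnd i; exists M; split => // K MK n _ /=.
  exact: uM MK (s n) Logic.I.
exists (s \o t) => [m n /=|j]; first by rewrite s_inc -leEnat t_inc.
rewrite inE => /predU1P[->//|/s_cvg/cvg_ex[l0 jl]].
apply/cvg_ex; exists l0; rewrite -[_ \o _]/((u j \o s) \o t).
exact: cvg_comp (increasing_seq_cvgn t_inc) jl.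
Qed.

End Sequences.

(** * Metric inequalities in CAT(0)-spaces *)

Section CAT0_inequalities.
Context {R : realType}.

Let pt (a b : R) : 'rV[R]_2 := \row_i (if i == 0 then a else b).

Let euclid_dist_pt a b c d :
  euclid_dist (pt a b) (pt c d) = Num.sqrt ((a - c) ^+ 2 + (b - d) ^+ 2).
Proof. by rewrite /euclid_dist !big_ord_recl big_ord0 !mxE /= addr0. Qed.

(** With two vertices at (0, 0) and (a, 0), the abscissa [s] of the third is dictated by the law of
    cosines; the triangle inequalities give [|s| <= c], so its ordinate is real. *)
Lemma euclidean_triangle_exists (a b c : R) : 0 <= a -> 0 <= b -> 0 <= c ->
  a <= b + c -> b <= a + c -> c <= a + b ->
  exists s t, s ^+ 2 + t ^+ 2 = c ^+ 2 /\ (a - s) ^+ 2 + t ^+ 2 = b ^+ 2.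
Proof.
move=> a0 b0 c0 abc bac cab; have [a_eq0|a_neq0] := eqVneq a 0.
  (* The law of cosines divides by [a], so the degenerate side is treated apart. *)
  exists 0, c; have -> : b = c by lra.
  by rewrite a_eq0 subr0 expr0n add0r.
have a_gt0 : 0 < a by rewrite lt0r a_neq0.
pose s := (a ^+ 2 + c ^+ 2 - b ^+ 2) / (2 * a).
have as2 : 2 * a * s = a ^+ 2 + c ^+ 2 - b ^+ 2 by rewrite /s; field.
have sc : s <= c by rewrite /s ler_pdivrMr; nra.
have cs : - c <= s by rewrite /s ler_pdivlMr; nra.
exists s, (Num.sqrt (c ^+ 2 - s ^+ 2)); rewrite sqr_sqrtr; last by nra.
by split; nra.
Qed.

Context {T : metricType R}.
Implicit Types (w x y z m : T) (S : set T).

Lemma geodesic_segment_left x y S : geodesic_segment x y S -> S x.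
Proof.
by case=> c [c0 _ _ ->]; exists 0 => //=; rewrite in_itv /= lexx mdist_ge0.
Qed.

Lemma geodesic_segment_midpoint x y S : geodesic_segment x y S ->
  exists m, [/\ S m, mdist x m = mdist x y / 2 & mdist y m = mdist x y / 2].
Proof.
case=> c [c0 cD c_isom ->]; have D0 := mdist_ge0 x y.
have half_in : mdist x y / 2 \in `[0, mdist x y] by rewrite in_itv /=; lra.
have l_in : 0 \in `[0, mdist x y] by rewrite in_itv /= lexx.
have r_in : mdist x y \in `[0, mdist x y] by rewrite in_itv /= lexx D0.
exists (c (mdist x y / 2)); split; first by exists (mdist x y / 2).
  by rewrite -{1}c0 c_isom // sub0r normrN ger0_norm //; lra.
rewrite -{1}cD c_isom // ger0_norm; lra.
Qed.

Lemma comparison_triangle_exists x y z :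
  exists s t, comparison_triangle x y z (pt 0 0) (pt (mdist x y) 0) (pt s t).
Proof.
have [||||||s [t [st ast]]] := @euclidean_triangle_exists
  (mdist x y) (mdist y z) (mdist z x); rewrite ?mdist_ge0 //.
- have := metric_triangle x z y.
  by rewrite [mdist x z]metric_sym [mdist z y]metric_sym addrC.
- have := metric_triangle y x z.
  by rewrite [mdist y x]metric_sym [mdist x z]metric_sym.
- have := metric_triangle z y x.
  by rewrite [mdist z y]metric_sym [mdist y x]metric_sym addrC.
exists s, t; split; rewrite euclid_dist_pt ?sub0r ?subr0 ?sqrrN ?expr0n ?addr0.
- by rewrite sqrtr_sqr ger0_norm ?mdist_ge0.
- by rewrite ast sqrtr_sqr ger0_norm ?mdist_ge0.
- by rewrite st sqrtr_sqr ger0_norm ?mdist_ge0.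
Qed.

(** The last clause is the Bruhat-Tits (CN) inequality: the distance from [z] to the midpoint is
    compared with a median of the Euclidean comparison triangle, whose length the median formula
    gives. *)
Lemma CAT0_midpoint x y : CAT0 T ->
  exists m, [/\ mdist x m = mdist x y / 2, mdist y m = mdist x y / 2
    & forall z, mdist z m ^+ 2 <=
        mdist z x ^+ 2 / 2 + mdist z y ^+ 2 / 2 - mdist x y ^+ 2 / 4].
Proof.
move=> [geoT cmpT]; have [S Sxy] := geoT x y.
have [m [Sm xm ym]] := geodesic_segment_midpoint Sxy.
exists m; split=> // z; have [Syz Syz_geo] := geoT y z.
have [Szx Szx_geo] := geoT z x.
have [s [t tri]] := comparison_triangle_exists x y z.
have D0 := mdist_ge0 x y.
have le_zm : mdist z m <= euclid_dist (pt s t) (pt (mdist x y / 2) 0).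
  apply: (cmpT _ _ _ _ _ _ _ _ _ Sxy Syz_geo Szx_geo tri).
  (* The vertex [z] enters as an endpoint of the side from [z] to [x], and [m] as the middle of the
     side from [x] to [y]. *)
  - apply: Or33; split; first exact: geodesic_segment_left Szx_geo.
      exists 0; first by rewrite /= in_itv /= lexx ler01.
      by rewrite subr0 scale1r scale0r addr0.
    by rewrite mdistxx euclid_dist_pt !subrr expr0n addr0 sqrtr0.
  - apply: Or31; split=> //.
      exists (1 / 2); first by rewrite /= in_itv /=; lra.
      by apply/rowP => i; rewrite !mxE; case: ifP => _; field.
    rewrite xm euclid_dist_pt subrr expr0n addr0 sub0r sqrrN sqrtr_sqr.
    by rewrite ger0_norm //; lra.
case: tri => _ yz zx.
have := le_zm; rewrite -(@ler_pXn2r _ 2) ?nnegrE ?mdist_ge0 ?sqrtr_ge0 //.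
move=> /le_trans; apply.
move: yz zx; rewrite !euclid_dist_pt [mdist z y]metric_sym => <- <-.
rewrite !sqr_sqrtr ?addr_ge0 ?sqr_ge0 //; nra.
Qed.

(* Both x and z are compared with the midpoint m of [w, y], and
   d(x, z)^2 <= 2 d(x, m)^2 + 2 d(m, z)^2. *)
Lemma CAT0_quadrilateral w x y z : CAT0 T ->
  mdist w y ^+ 2 + mdist x z ^+ 2 <=
  mdist w x ^+ 2 + mdist x y ^+ 2 + mdist y z ^+ 2 + mdist z w ^+ 2.
Proof.
move=> /(CAT0_midpoint w y)[m [_ _ le_m]].
have := le_m x; have := le_m z; have := metric_triangle x m z.
rewrite [mdist x w]metric_sym [mdist z y]metric_sym [mdist m z]metric_sym.
have := mdist_ge0 x z; have := mdist_ge0 x m; have := mdist_ge0 z m.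
move: (mdist x z) (mdist x m) (mdist z m) => d e f f0 e0 d0 def lez lex.
suff: d ^+ 2 <= 2 * e ^+ 2 + 2 * f ^+ 2 by lra.
have := sqr_ge0 (e - f); nra.
Qed.

End CAT0_inequalities.

(** * Maximal self-stable families *)

Section MaximalFamilies.
Context {R : realType} {X : metricType R}.
Implicit Types (r : normalizingSeq R) (p : X) (G : set (nat -> X)).

Lemma mutually_stable_refl r x : mutually_stable (X := X) r x x.
Proof.
rewrite /mutually_stable (_ : scaled_dist r x x = cst 0); first exact: is_cvg_cst.
by apply/funext => n; rewrite /scaled_dist mdistxx mul0r.
Qed.

Lemma mutually_stable_sym r (x y : nat -> X) :
  mutually_stable r x y -> mutually_stable r y x.
Proof.
rewrite /mutually_stable (_ : scaled_dist r x y = scaled_dist r y x) //.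
by apply/funext => n; rewrite /scaled_dist metric_sym.
Qed.

(** By Zorn's lemma: a maximal element absorbs [G], and also every sequence stable with all its
    members. *)
Lemma maximal_family_exists r p G : self_stable r G -> G (cst p) ->
  exists F : maximalFamily r p, G `<=` Defs.family F.
Proof.
(* Uniting with [G] inside [P], rather than asking that [A] contain [G], makes [P] hold for the
   union of the empty chain too. *)
move=> stG Gp; pose P A := self_stable r (A `|` G).
have [C CP totC|A [PA maxA]] := @Zorn_bigcup _ P.
  move=> x y [[A CA Ax]|Gx] [[B CB By]|Gy].
  - have [AB|BA] := totC _ _ CA CB.
      by apply: (CP _ CB); left => //; apply: AB.
    by apply: (CP _ CA); left => //; apply: BA.
  - by apply: (CP _ CA); [left|right].
  - by apply: (CP _ CB); [right|left].
  - exact: stG.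
have GA : G `<=` A.
  move=> z Gz; apply: contrapT => nAz; apply: (maxA (A `|` G)).
    split; first exact: subsetUl.
    by move=> /(_ z) /=; apply: contra_not nAz; apply; right.
  by rewrite /P -setUA setUid.
have stA : self_stable r A by move=> x y Ax Ay; apply: PA; left.
have maxlA : maximal_self_stable r A.
  split=> // z nAz; apply: contrapT => stable_z; apply: (maxA (A `|` [set z])).
    split; first exact: subsetUl.
    by move=> /(_ z) /=; apply: contra_not nAz; apply; right.
  have Az x : A x -> mutually_stable r x z.
    by move=> Ax; apply: contrapT => nxz; apply: stable_z; exists x.
  rewrite /P setUAC (setUidl GA).
  move=> x y [Ax|->] [Ay|->].
  - exact: stA.
  - exact: Az.
  - exact/mutually_stable_sym/Az.
  - exact: mutually_stable_refl.
by exists (MaximalFamily maxlA (GA _ Gp)).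
Qed.

Lemma normalizing_comp_cvg0 r (s : nat -> nat) :
  s @ \oo --> \oo -> r \o s @ \oo --> (0 : R).
Proof. by move=> s_oo; apply: cvg_comp s_oo (nseq_cvg0 r). Qed.

(** Reindexing the scale together with the points makes [scaled_dist] of [x \o s] and [y \o s] the
    composite of the original [scaled_dist] with [s]. *)
Definition normalizing_comp r (s : nat -> nat) (s_oo : s @ \oo --> \oo) :=
  NormalizingSeq (fun n => nseq_gt0 r (s n)) (normalizing_comp_cvg0 r s_oo).

(** The scaled distances are at most 2, by the triangle inequality through [p], so a common
    subsequence makes them all converge. *)
Lemma maximal_family_subsequence r p (I : finType) (P : I -> nat -> X) :
  (forall i n, mdist (P i n) p <= r n) ->
  exists s : nat -> nat, exists s_oo : s @ \oo --> \oo,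
  exists F : maximalFamily (normalizing_comp r s_oo) p,
    forall i, Defs.family F (P i \o s).
Proof.
(* [None] indexes the constant sequence at [p], which the family must contain. *)
move=> P_le; pose Q (i : option I) := if i is Some i then P i else cst p.
have Q_le i n : mdist (Q i n) p <= r n.
  by case: i => [i|] //=; rewrite mdistxx ltW ?nseq_gt0.
have [ij|s s_inc s_cvg] := @bolzano_weierstrass_finite R
    (option I * option I)%type (fun ij => scaled_dist r (Q ij.1) (Q ij.2)).
  exists 2; split => // K K2 n _ /=.
  rewrite /scaled_dist ger0_norm ?divr_ge0 ?mdist_ge0 ?(ltW (nseq_gt0 _ _)) //.
  rewrite ler_pdivrMr ?nseq_gt0 //; have := nseq_gt0 r n.
  have := Q_le ij.1 n; have := Q_le ij.2 n.
  have := metric_triangle (Q ij.1 n) p (Q ij.2 n).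
  rewrite [mdist p _]metric_sym; nra.
have s_oo := increasing_seq_cvgn s_inc; exists s, s_oo.
have [||F GF] := @maximal_family_exists (normalizing_comp r s_oo) p
    (range (fun i => Q i \o s)).
- by move=> _ _ [i _ <-] [j _ <-]; apply: (s_cvg (i, j)).
- by exists None.
- by exists F => i; apply: GF; exists (Some i).
Qed.

(** * From pretangent spaces back to sequences *)

Section MaximalFamily.
Context {r : normalizingSeq R} {p : X} (F : maximalFamily r p).

Lemma scaled_dist_cvg x y : Defs.family F x -> Defs.family F y ->
  scaled_dist r x y @ \oo --> dtilde r x y.
Proof. exact: (family_maximal F).1. Qed.

Definition pretangent_class x (Fx : Defs.family F x) : pretangent F :=
  \pi_(pretangent F) (SigSub (mem_set Fx)).

Lemma mdist_pretangent_class x y (Fx : Defs.family F x) (Fy : Defs.family F y) :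
  mdist (pretangent_class Fx) (pretangent_class Fy) = dtilde r x y.
Proof. by rewrite mdist_pretangentE pretangent_dist_pi. Qed.

Lemma pretangent_classP (b : pretangent F) :
  exists z (Fz : Defs.family F z), b = pretangent_class Fz.
Proof.
exists (val (repr b)), (set_valP (repr b)).
rewrite -[LHS]reprK /pretangent_class; congr (\pi _); exact/val_inj.
Qed.

(** A representative of the midpoint class lies in the family, hence is stable with [x] and [y] and
    supplies their midpoints in [X] up to a small error. *)
Lemma CAT0_pretangent_midpoint x y : CAT0 (pretangent F) ->
  Defs.family F x -> Defs.family F y ->
  exists2 z, Defs.family F z & dtilde r x z = dtilde r x y / 2 /\
                   dtilde r y z = dtilde r x y / 2.
Proof.
move=> cat Fx Fy.
have [m [xm ym _]] :=
  CAT0_midpoint (pretangent_class Fx) (pretangent_class Fy) cat.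
have [z [Fz mz]] := pretangent_classP m; exists z => //.
by move: xm ym; rewrite mz !mdist_pretangent_class.
Qed.

Lemma CAT0_pretangent_quadrilateral w x y z : CAT0 (pretangent F) ->
  Defs.family F w -> Defs.family F x -> Defs.family F y -> Defs.family F z ->
  dtilde r w y ^+ 2 + dtilde r x z ^+ 2 <=
  dtilde r w x ^+ 2 + dtilde r x y ^+ 2 + dtilde r y z ^+ 2 + dtilde r z w ^+ 2.
Proof.
move=> cat Fw Fx Fy Fz; have := CAT0_quadrilateral (pretangent_class Fw)
  (pretangent_class Fx) (pretangent_class Fy) (pretangent_class Fz) cat.
by rewrite !mdist_pretangent_class.
Qed.

End MaximalFamily.
End MaximalFamilies.

(** * Midpoint convexity at [p] and the lower limit of [A1] *)

Section Infinitesimal.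
Context {R : realType} {X : metricType R} (p : X).
Context (cat0 : forall (r : normalizingSeq R) (F : maximalFamily r p),
  CAT0 (pretangent F)).

Lemma mdist_cvg0 (x : nat -> X) :
  x @ \oo --> p -> mdist (x n) p @[n --> \oo] --> 0.
Proof.
move=> /metricType_numDomainType.cvgrPdist_lt xp.
apply/cvgr0Pnorm_lt => e /xp; apply: filterS => n.
by rewrite metric_sym ger0_norm ?mdist_ge0.
Qed.

(* Where x = y = p the division by 0 makes this 0 for every z. *)
Let err (x y z : X) :=
  (`|mdist x z - mdist x y / 2| + `|mdist y z - mdist x y / 2|) / delta p x y.

Let delta_ge0 x y : 0 <= delta p x y.
Proof. by rewrite le_max mdist_ge0. Qed.

Let err_ge0 x y z : 0 <= err x y z.
Proof. by rewrite divr_ge0 // addr_ge0. Qed.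

(** Here the midpoint may depend on the tolerance [e]; one sequence serving all tolerances is
    assembled in [midpoint_convex_of_CAT0]. *)
Lemma approximate_midpoint (x y : nat -> X) (e : R) :
  x @ \oo --> p -> y @ \oo --> p -> 0 < e ->
  \forall n \near \oo, exists z, err (x n) (y n) z < e.
Proof.
move=> xp yp e0; apply: contrapT => nnear.
(* Beyond each [N], [f] picks an index where every [z] misses by at least [e]; it tends to infinity
   but need not increase. *)
have /choice[f fP] N : exists n, (N <= n)%N /\ forall z, e <= err (x n) (y n) z.
  apply: contrapT => nex; apply: nnear; exists N => // n /= Nn.
  apply: contrapT => nez; apply: nex; exists n; split => // z.
  by rewrite leNgt; apply/negP => ze; apply: nez; exists z.
have f_oo : f @ \oo --> \oo by apply: cvgn_oo_of_ge => n; have [] := fP n.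
pose d n := delta p (x (f n)) (y (f n)).
(* If [d n] were 0, division by 0 would make [err] equal to 0, below [e]. *)
have d_gt0 n : 0 < d n.
  rewrite lt0r delta_ge0 andbT; apply: contraTneq e0 => dn0.
  by have [_ /(_ p)] := fP n; rewrite /err -/(d n) dn0 invr0 mulr0 leNgt.
have d_cvg0 : d @ \oo --> (0 : R).
  have sum_cvg0 : mdist (x (f n)) p + mdist (y (f n)) p @[n --> \oo] --> (0 : R).
    rewrite -[X in _ --> X]addr0; apply: cvgD.
      exact: cvg_comp f_oo (mdist_cvg0 xp).
    exact: cvg_comp f_oo (mdist_cvg0 yp).
  apply: (squeeze_cvgr _ (cvg_cst 0) sum_cvg0); apply: nearW => n.
  by rewrite delta_ge0 /d /delta /= ge_max lerDl lerDr !mdist_ge0.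
pose r := NormalizingSeq d_gt0 d_cvg0.
pose P (b : bool) := if b then x \o f else y \o f.
have [|s [s_oo [F FP]]] := @maximal_family_subsequence _ _ r p _ P.
  by case=> n; rewrite /= /d le_max lexx ?orbT.
have [z Fz [xz yz]] := CAT0_pretangent_midpoint (cat0 F) (FP true) (FP false).
have Dxy := scaled_dist_cvg (FP true) (FP false).
have Dxz := scaled_dist_cvg (FP true) Fz.
have Dyz := scaled_dist_cvg (FP false) Fz.
have half_cvg0 (u v : R^nat) (l : R) : u @ \oo --> l / 2 -> v @ \oo --> l ->
    `|u n - v n / 2| @[n --> \oo] --> (0 : R).
  move=> ul vl; rewrite -[X in _ --> X](@normr0 _ R) -(subrr (l / 2)).
  by apply: cvg_norm; apply: cvgB ul _; apply: cvgM vl (cvg_cst _).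
rewrite xz in Dxz; rewrite yz in Dyz.
have err_cvg0 := cvgD (FF := eventually_filter)
  (half_cvg0 _ _ _ Dxz Dxy) (half_cvg0 _ _ _ Dyz Dxy).
(* The errors of [z] along [f \o s] are the scaled errors just shown to tend to 0, whereas [f] only
   picks indices where every error is at least [e]. *)
have [N _ NP] : \forall n \near \oo, err (x (f (s n))) (y (f (s n))) (z n) < e.
  move: err_cvg0; rewrite addr0 => /cvgr0Pnorm_lt/(_ _ e0).
  apply: filterS => n; rewrite ger0_norm ?addr_ge0 //.
  congr (_ < _); rewrite /scaled_dist /err /= -/(d (s n)).
  have dV : 0 <= (d (s n))^-1 by rewrite invr_ge0 ltW.
  rewrite mulrDl -[in RHS](ger0_norm dV) -!normrM.
  by rewrite fctE; congr (_ + _); congr (Num.norm _); ring.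
have := NP N (leqnn N); have [_ /(_ (z N))] := fP (s N).
by rewrite leNgt => /negP.
Qed.

(** Choosing points within 1/(n+1) of the infimum of the attainable errors handles all tolerances at
    once, since [approximate_midpoint] eventually puts this infimum below [e / 2]. *)
Lemma midpoint_convex_of_CAT0 : midpoint_convex p.
Proof.
move=> x y xp yp; pose E n := range (err (x n) (y n)).
have E_inf n : has_inf (E n).
  split; first by exists (err (x n) (y n) p), p.
  by exists 0 => _ [z _ <-]; exact: err_ge0.
have /choice[z0 z0P] n : exists z, err (x n) (y n) z < inf (E n) + n.+1%:R^-1.
  have n0 : 0 < n.+1%:R^-1 :> R by rewrite invr_gt0.
  by have [_ [z _ <-] ?] := inf_adherent n0 (E_inf n); exists z.
(* At [x n = y n = p] the real-valued [err] is 0 whatever the point, but [midpoint_error] is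
   infinite unless the midpoint is [p]. *)
pose z n := if (x n == p) && (y n == p) then p else z0 n.
exists z.
have errz : err (x n) (y n) (z n) @[n --> \oo] --> (0 : R).
  apply/cvgr0Pnorm_lt => e e0.
  have e2 : 0 < e / 2 by rewrite divr_gt0.
  near=> n; rewrite ger0_norm ?err_ge0 // /z.
  case: ifP => [/andP[/eqP-> /eqP->]|_].
    by rewrite /err !mdistxx mul0r subrr normr0 addr0 mul0r.
  apply: lt_trans (z0P n) _; rewrite [e]splitr; apply: ltrD.
    have [u ue] : exists u, err (x n) (y n) u < e / 2.
      by near: n; exact: approximate_midpoint.
    by apply: le_lt_trans ue; apply: ge_inf; [exact: (E_inf n).2|exists u].
  by near: n; exact: near_infty_natSinv_lt (PosNum e2).
have midpoint_errorE a n : midpoint_error p a (x n) (y n) (z n) =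
    if (x n == p) && (y n == p) then 0%E else
    (`|mdist a (z n) - mdist (x n) (y n) / 2| / delta p (x n) (y n))%:E.
  by rewrite /midpoint_error /z; case: ifP => -> //=; rewrite eqxx.
(* Each of the two errors is a summand of [err], so it is squeezed to 0. *)
have error_cvg0 (a : X^nat) :
    (forall n, `|mdist (a n) (z n) - mdist (x n) (y n) / 2| /
      delta p (x n) (y n) <= err (x n) (y n) (z n)) ->
    midpoint_error p (a n) (x n) (y n) (z n) @[n --> \oo] --> 0%E.
  move=> a_le.
  have : `|mdist (a n) (z n) - mdist (x n) (y n) / 2| / delta p (x n) (y n)
      @[n --> \oo] --> (0 : R).
    apply: (squeeze_cvgr _ (cvg_cst 0) errz); apply: nearW => n.
    by rewrite a_le divr_ge0.
  move=> cvg0; suff -> : (fun n => midpoint_error p (a n) (x n) (y n) (z n)) =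
      EFin \o (fun n => `|mdist (a n) (z n) - mdist (x n) (y n) / 2| /
                        delta p (x n) (y n)).
    by apply: cvg_EFin cvg0; apply: nearW.
  apply/funext => n; rewrite midpoint_errorE /=.
  case: ifP => // /andP[/eqP xE /eqP yE].
  by rewrite /delta xE yE mdistxx maxxx invr0 mulr0.
split; apply: error_cvg0 => n; rewrite ler_wpM2r ?invr_ge0 // ?lerDl ?lerDr.
Unshelve. all: by end_near.
Qed.

(** Quadruples at distance less than 1/(n+1) from [p] with [A1 < - e] would yield in the limit four
    points of a pretangent space violating [CAT0_quadrilateral]. *)
Lemma A1_eventually_ge (e : R) : 0 < e ->
  exists2 d : R, 0 < d & forall w x y z, mdist w p < d -> mdist x p < d ->
    mdist y p < d -> mdist z p < d -> - e <= A1 p w x y z.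
Proof.
move=> e0; apply: contrapT => nex.
have /choice[q qP] n : exists q : X * X * X * X,
    [/\ mdist q.1.1.1 p < n.+1%:R^-1, mdist q.1.1.2 p < n.+1%:R^-1,
        mdist q.1.2 p < n.+1%:R^-1 & mdist q.2 p < n.+1%:R^-1] /\
    A1 p q.1.1.1 q.1.1.2 q.1.2 q.2 < - e.
  apply: contrapT => nq; apply: nex; exists n.+1%:R^-1 => // w x y z wn xn yn zn.
  by rewrite leNgt; apply/negP => A1e; apply: nq; exists (w, x, y, z).
pose w n := (q n).1.1.1; pose x n := (q n).1.1.2.
pose y n := (q n).1.2; pose z n := (q n).2.
pose d n := Num.max (Num.max (Num.max (mdist (w n) p) (mdist (x n) p))
  (mdist (y n) p)) (mdist (z n) p).
(* When all four points are [p], the quotient is 0 / 0 = 0, in agreement with the convention in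
   [A1]. *)
have A1E n : A1 p (w n) (x n) (y n) (z n) =
    (mdist (w n) (x n) ^+ 2 + mdist (x n) (y n) ^+ 2 + mdist (y n) (z n) ^+ 2
     + mdist (z n) (w n) ^+ 2 - (mdist (w n) (y n) ^+ 2 + mdist (x n) (z n) ^+ 2))
    / d n ^+ 2.
  rewrite /A1; case: ifP => // /and4P[/eqP-> /eqP-> /eqP-> /eqP->].
  by rewrite !mdistxx expr0n /= !addr0 subrr mul0r.
have d_gt0 n : 0 < d n.
  have d_ge0 : 0 <= d n by rewrite /d le_max mdist_ge0 orbT.
  rewrite lt0r d_ge0 andbT; apply: contraTneq e0 => dn0.
  have [_] := qP n; rewrite -/(w n) -/(x n) -/(y n) -/(z n) A1E dn0.
  by rewrite expr0n invr0 mulr0 oppr_gt0 ltNge => /negP ne; apply/negP => /ltW.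
have d_cvg0 : d @ \oo --> (0 : R).
  apply/cvgr0Pnorm_lt => e' e'0; near=> n; rewrite gtr0_norm //.
  have [[wn xn yn zn] _] := qP n; apply: (@lt_trans _ _ n.+1%:R^-1).
    by rewrite !gt_max wn xn yn zn.
  by near: n; exact: near_infty_natSinv_lt (PosNum e'0).
pose r := NormalizingSeq d_gt0 d_cvg0.
pose P (i : 'I_4) := nth w [:: w; x; y; z] i.
have [|s [s_oo [F FP]]] := @maximal_family_subsequence _ _ r p _ P.
  by case=> -[|[|[|[|//]]]] ? n; rewrite /= /d !le_max lexx ?orbT.
have Fw := FP (@Ordinal 4 0 isT); have Fx := FP (@Ordinal 4 1 isT).
have Fy := FP (@Ordinal 4 2 isT); have Fz := FP (@Ordinal 4 3 isT).
have := CAT0_pretangent_quadrilateral (cat0 F) Fw Fx Fy Fz.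
rewrite -subr_ge0 leNgt => /negP; apply.
pose D := @scaled_dist R X (normalizing_comp r s_oo).
have sqr_cvg a b (Fa : Defs.family F a) (Fb : Defs.family F b) :
    D a b n ^+ 2 @[n --> \oo] --> dtilde (normalizing_comp r s_oo) a b ^+ 2.
  by rewrite expr2; exact: (cvgM (scaled_dist_cvg Fa Fb) (scaled_dist_cvg Fa Fb)).
have sum_cvg (u v : R^nat) (l m : R) : u @ \oo --> l -> v @ \oo --> m ->
    u n + v n @[n --> \oo] --> l + m by exact: cvgD.
have lim_A1 := cvgB (FF := eventually_filter)
  (sum_cvg _ _ _ _ (sum_cvg _ _ _ _ (sum_cvg _ _ _ _ (sqr_cvg _ _ Fw Fx)
    (sqr_cvg _ _ Fx Fy)) (sqr_cvg _ _ Fy Fz)) (sqr_cvg _ _ Fz Fw))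
  (sum_cvg _ _ _ _ (sqr_cvg _ _ Fw Fy) (sqr_cvg _ _ Fx Fz)).
(* The denominator of [A1] is the squared scale, so [A1] along [s] is this combination of squared
   scaled distances, and the limit inherits the bound [- e]. *)
apply: (@le_lt_trans _ _ (- e)); last by rewrite oppr_lt0.
rewrite -(cvg_lim _ lim_A1) //; apply: limr_le.
  by apply/cvg_ex; eexists; exact: lim_A1.
apply: nearW => n; have [_ /ltW] := qP (s n); apply: le_trans.
rewrite -/(w (s n)) -/(x (s n)) -/(y (s n)) -/(z (s n)) A1E.
rewrite !fctE /D /scaled_dist /P /=.
have ds := d_gt0 (s n); have ds0 := lt0r_neq0 ds.
rewrite le_eqVlt; apply/orP; left; apply/eqP; field.
Unshelve. all: by end_near.
Qed.

(** As a supremum of infima over neighbourhoods, the lower limit is at least the infimum over the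
    fourfold product of a ball around [p], which [A1_eventually_ge] bounds below by [- e]. *)
Lemma liminf_A1_ge0 : (0 <= liminf_A1 p)%E.
Proof.
rewrite /liminf_A1 limf_einfE; apply/lee_addgt0Pr => e e0.
have [d d0 A1_ge] := A1_eventually_ge e0.
rewrite -leeBlDr // sub0e; apply: le_ereal_sup_tmp.
pose B := ball p d; have pB : nbhs p B by exact: nbhsx_ballx.
have nbhs_setX (T U : topologicalType) (t : T) (u : U) C D :
  nbhs t C -> nbhs u D -> nbhs (t, u) (C `*` D) by move=> tC uD; exists (C, D).
exists (ereal_inf [set (A1 p q.1.1.1 q.1.1.2 q.1.2 q.2)%:E | q in
   B `*` B `*` B `*` B]).
  exists (B `*` B `*` B `*` B) => //.
  exact: nbhs_setX (nbhs_setX _ _ _ _ _ _ (nbhs_setX _ _ _ _ _ _ pB pB) pB) pB.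
apply/ereal_infP => _ [q [[[wB xB] yB] zB] <-]; rewrite -EFinN lee_fin.
move: wB xB yB zB; rewrite /B ballEmdist /= ![mdist p _]metric_sym.
exact: A1_ge.
Qed.

End Infinitesimal.

Theorem mainTheorem2 (R : realType) (X : metricType R) (p : X) :
  (forall (r : normalizingSeq R) (F : maximalFamily r p),
     CAT0 (pretangent F)) ->
  midpoint_convex p /\ (0 <= liminf_A1 p)%E.
Proof.
by move=> cat0; split; [exact: midpoint_convex_of_CAT0|exact: liminf_A1_ge0].
Qed.
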